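(* Let $T$ be a fixed finite rooted bandit tree (as defined in the context) with binary-reward leaves. Suppose that each leaf $\ell$ has true win rate $p_\ell$ with $0<p_\ell<1$, and that the prior density at each leaf is strictly positive on $(0,1)$ and differentiable there with bounded derivative. Suppose that no two sibling nodes of $T$ have exactly equal minimax values. Let $\Pi$ be any sampling policy under which every leaf is sampled an unbounded number of times as the total number of samples $N\to\infty$. Then, with probability $1$, for every interior node $v$ of $T$, the posterior distribution $P_v^{(N)}$ at $v$ after $N$ samples converges weakly, as $N\to\infty$, to the Dirac measure $\delta_{V(v)}$ at the minimax value $V(v)$ of $v$.
   Context: Bandit tree: a finite rooted tree in which every interior (non-leaf) node has a nonempty set of children and is designated either a MAX node or a MIN node. Each leaf $\ell$ is a bandit arm with a fixed payoff rate $p_\ell$: each sample of $\ell$ yields a reward in $\{0,1\}$, equal to $1$ with probability $p_\ell$; the rewards from successive samples of $\ell$ are i.i.d., and the reward sequences of different leaves are independent. Minimax value (minimax payoff rate): $V(\ell)=p_\ell$ for a leaf $\ell$; $V(v)=\max_c V(c)$ for a MAX node $v$ and $V(v)=\min_c V(c)$ for a MIN node $v$, with $c$ ranging over the children of $v$. Sampling policy: a rule that at each step chooses a leaf to sample, possibly depending on all past choices and rewards and on auxiliary randomization independent of the rewards (e.g. uniform random sampling). Leaf posteriors: each leaf $\ell$ has a prior probability density $f_\ell$ on $(0,1)$ for its payoff rate. After $W$ rewards equal to $1$ and $L$ rewards equal to $0$ have been observed at $\ell$, its posterior $P_\ell$ is the distribution on $(0,1)$ with density proportional to $p^{W}(1-p)^{L}f_\ell(p)$.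 Interior node posteriors: defined recursively from the leaves upward, treating sibling distributions as independent. If the children $c$ of $v$ have distributions with CDFs $C_c$, then the distribution $P_v$ has CDF $C_v(x)=\prod_c C_c(x)$ if $v$ is a MAX node, and $C_v(x)=1-\prod_c (1-C_c(x))$ if $v$ is a MIN node. $P_v^{(N)}$ denotes $P_v$ computed after $N$ total samples in the tree. *)

(* Defs.v *)
From HB Require Import structures.
From mathcomp Require Import all_boot all_order all_algebra.
From mathcomp Require Import finmap.
From mathcomp Require Import all_classical all_reals all_analysis.
From mathcomp Require Import measurable_realfun.

Set Implicit Arguments.
Unset Strict Implicit.
Unset Printing Implicit Defensive.

Import Order.TTheory GRing.Theory Num.Theory.
Import numFieldNormedType.Exports.

Local Open Scope classical_set_scope.
Local Open Scope ring_scope.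

Variant player := MAX | MIN.

(* An interior node has [n.+1] children, hence at least one. *)
Inductive bandit_tree (L : Type) : Type :=
| Leaf of L
| Node (k : player) (n : nat) of ('I_n.+1 -> bandit_tree L).

Fixpoint leaves (L : Type) (t : bandit_tree L) : seq L :=
  match t with
  | Leaf l => [:: l]
  | Node _ n c => flatten [seq leaves (c i) | i <- enum 'I_n.+1]
  end.

(* The leaves of the tree are in bijection with the arms [L].  In such a tree
   distinct nodes root distinct subtrees, so that a node can be identified
   with the subtree below it. *)
Definition arms_are_leaves (L : finType) (t : bandit_tree L) : Prop :=
  perm_eq (leaves t) (enum L).

Inductive node_of (L : Type) (t : bandit_tree L) : bandit_tree L -> Prop :=
| node_root : node_of t t
| node_child k n (c : 'I_n.+1 -> bandit_tree L) i :
    node_of t (Node k c) -> node_of t (c i).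

Definition is_interior (L : Type) (t : bandit_tree L) : bool :=
  if t is Node _ _ _ then true else false.

(* The first child serves as the unit of the iterated max (min); it is also
   one of the terms, so it does not affect the result. *)
Fixpoint minimax (R : realType) (L : Type) (p : L -> R) (t : bandit_tree L) : R :=
  match t with
  | Leaf l => p l
  | Node MAX n c =>
      \big[Num.max/minimax p (c ord0)]_(i < n.+1) minimax p (c i)
  | Node MIN n c =>
      \big[Num.min/minimax p (c ord0)]_(i < n.+1) minimax p (c i)
  end.

Definition siblings_distinct (R : realType) (L : Type) (p : L -> R)
    (t : bandit_tree L) : Prop :=
  forall k n (c : 'I_n.+1 -> bandit_tree L), node_of t (Node k c) ->
  forall i j, i != j -> minimax p (c i) != minimax p (c j).

Definition law (R : realType) := probability (measurableTypeR R) R.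

Definition cdf_of (R : realType) (Q : law R) (x : R) : R :=
  fine (Q `]-oo, x]%classic).

Section cdf_of_cumulative.
Local Open Scope measure_display_scope.
Context {R : realType} (Q : law R).

Let idTR : measurableTypeR R -> R := idfun.

#[local] HB.instance Definition _ :=
  @isMeasurableFun.Build _ _ _ _ idTR (@measurable_id _ _ setT).

Let cdf_ofE : cdf_of Q = fun x => fine (cdf (idTR : {RV Q >-> R}) x).
Proof. by apply/funext => x; rewrite /cdf_of /cdf /distribution /pushforward preimage_id. Qed.

Lemma cdf_of_nondecreasing : nondecreasing (cdf_of Q).
Proof.
by rewrite cdf_ofE => x y xy; rewrite fine_le ?fin_num_measure// cdf_nondecreasing.
Qed.

Lemma cdf_of_right_continuous : right_continuous (cdf_of Q).
Proof.
rewrite cdf_ofE => a; apply: fine_cvg.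
by rewrite fineK ?fin_num_measure//; exact: cdf_right_continuous.
Qed.

Lemma cdf_of_Ny : cdf_of Q @ -oo --> (0 : R).
Proof. by rewrite cdf_ofE; exact/fine_cvg/cvg_cdfNy0. Qed.

Lemma cdf_of_y : cdf_of Q @ +oo --> (1 : R).
Proof. by rewrite cdf_ofE; exact/fine_cvg/cvg_cdfy1. Qed.

Lemma cdf_of_ge0 x : 0 <= cdf_of Q x.
Proof. by rewrite fine_ge0. Qed.

Lemma cdf_of_le1 x : cdf_of Q x <= 1.
Proof.
by rewrite -[1]/(fine 1%E) fine_le ?fin_num_measure// probability_le1.
Qed.

End cdf_of_cumulative.

Section max_min_law.
Context {R : realType} {n : nat} (Q : 'I_n.+1 -> law R).

Definition max_cdf (x : R) : R := \prod_(i < n.+1) cdf_of (Q i) x.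

Definition min_cdf (x : R) : R := 1 - \prod_(i < n.+1) (1 - cdf_of (Q i) x).

Let cvg_prod (F : set_system R) (g : 'I_n.+1 -> R -> R) (a : 'I_n.+1 -> R) :
  Filter F -> (forall i, g i x @[x --> F] --> a i) ->
  (fun x => \prod_(i < n.+1) g i x) @ F --> \prod_(i < n.+1) a i.
Proof. by move=> FF cg; apply: cvg_big => // -[x y]; exact: mul_continuous. Qed.

Let max_nd : nondecreasing max_cdf.
Proof.
move=> x y xy; apply: ler_prod => i _.
by rewrite cdf_of_ge0 cdf_of_nondecreasing.
Qed.

Let max_rc : right_continuous max_cdf.
Proof. by move=> x; apply: cvg_prod => i; exact: cdf_of_right_continuous. Qed.

Let max_Ny : max_cdf @ -oo --> (0 : R).
Proof.
have -> : (0 : R) = \prod_(i < n.+1) (0 : R) by rewrite big_ord_recl mul0r.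
by apply: cvg_prod => i; exact: cdf_of_Ny.
Qed.

Let max_y : max_cdf @ +oo --> (1 : R).
Proof.
have -> : (1 : R) = \prod_(i < n.+1) (1 : R) by rewrite big1.
by apply: cvg_prod => i; exact: cdf_of_y.
Qed.

HB.instance Definition _ := isCumulative.Build R _ R max_cdf max_nd max_rc.
HB.instance Definition _ := isCumulativeBounded.Build R 0 1 max_cdf max_Ny max_y.

Let min_nd : nondecreasing min_cdf.
Proof.
move=> x y xy; rewrite lerD2l lerN2; apply: ler_prod => i _.
by rewrite subr_ge0 cdf_of_le1 lerD2l lerN2 cdf_of_nondecreasing.
Qed.

Let min_rc : right_continuous min_cdf.
Proof.
move=> x; apply: cvgB; first exact: cvg_cst.
by apply: cvg_prod => i; apply: cvgB; [exact: cvg_cst|exact: cdf_of_right_continuous].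
Qed.

Let min_Ny : min_cdf @ -oo --> (0 : R).
Proof.
have -> : (0 : R) = 1 - \prod_(i < n.+1) (1 - 0 : R) by rewrite subr0 big1 ?subrr.
apply: cvgB; first exact: cvg_cst.
by apply: cvg_prod => i; apply: cvgB; [exact: cvg_cst|exact: cdf_of_Ny].
Qed.

Let min_y : min_cdf @ +oo --> (1 : R).
Proof.
have E : (1 : R) = 1 - \prod_(i < n.+1) (1 - 1 : R).
  by rewrite subrr big_ord_recl mul0r subr0.
rewrite [X in _ --> X]E.
apply: cvgB; first exact: cvg_cst.
by apply: cvg_prod => i; apply: cvgB; [exact: cvg_cst|exact: cdf_of_y].
Qed.

HB.instance Definition _ := isCumulative.Build R _ R min_cdf min_nd min_rc.
HB.instance Definition _ := isCumulativeBounded.Build R 0 1 min_cdf min_Ny min_y.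

Definition max_law : law R := lebesgue_stieltjes_measure max_cdf.

Definition min_law : law R := lebesgue_stieltjes_measure min_cdf.

Lemma cdf_max_law (x : R) : cdf_of max_law x = max_cdf x.
Proof.
rewrite /cdf_of -[RHS]/(fine (max_cdf x)%:E) -cdf_lebesgue_stieltjes_id.
by rewrite /cdf /distribution /pushforward preimage_id.
Qed.

Lemma cdf_min_law (x : R) : cdf_of min_law x = min_cdf x.
Proof.
rewrite /cdf_of -[RHS]/(fine (min_cdf x)%:E) -cdf_lebesgue_stieltjes_id.
by rewrite /cdf /distribution /pushforward preimage_id.
Qed.

End max_min_law.

(* Only the values on ]0, 1[ matter. *)
Record density01 (R : realType) := Density01 {
  density :> measurableTypeR R -> R ;
  density_measurable : measurable_fun (`]0, 1[%classic : set (measurableTypeR R)) density ;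
  density_ge0 : forall x, x \in `]0, 1[ -> 0 <= density x ;
  density_integral : (\int[lebesgue_measure]_(x in `]0%R, 1%R[) (density x)%:E = 1)%E
}.

Section leaf_posterior.
Context {R : realType} (f : density01 R) (w l : nat).

(* Density of the posterior, up to normalisation, after [w] rewards 1 and [l]
   rewards 0; extended by 0 outside ]0, 1[. *)
Definition posterior_density : measurableTypeR R -> R :=
  (fun x : R => x ^+ w * (1 - x) ^+ l * f x) \_ `]0, 1[.

Lemma posterior_density_ge0 x : 0 <= posterior_density x.
Proof.
rewrite /posterior_density patchE; case: ifPn => // /[!inE] /= x01.
rewrite mulr_ge0 ?density_ge0// mulr_ge0// exprn_ge0//.
  by move: x01; rewrite in_itv/= => /andP[/ltW].
by move: x01; rewrite in_itv/= subr_ge0 => /andP[_ /ltW].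
Qed.

Let measurable_likelihood :
  measurable_fun (`]0, 1[%classic : set (measurableTypeR R))
    (fun x : measurableTypeR R => (x : R) ^+ w * (1 - (x : R)) ^+ l).
Proof.
apply: measurable_funTS; apply: measurable_funM; first exact: exprn_measurable.
by apply: measurable_funX; exact: measurable_funB.
Qed.

Lemma measurable_posterior_density : measurable_fun setT posterior_density.
Proof.
apply/(measurable_restrictT _ _).1; first exact: measurable_itv.
by apply: measurable_funM; [exact: measurable_likelihood|exact: density_measurable].
Qed.

Definition unnormalized_posterior (A : set (measurableTypeR R)) : \bar R :=
  (\int[lebesgue_measure]_(x in A) (posterior_density x)%:E)%E.

Let unnormalized_posterior0 : unnormalized_posterior set0 = 0%E.
Proof. exact: integral_set0. Qed.

Let unnormalized_posterior_ge0 A : (0 <= unnormalized_posterior A)%E.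
Proof. by apply: integral_ge0 => x _; rewrite lee_fin posterior_density_ge0. Qed.

Let unnormalized_posterior_sigma_additive :
  semi_sigma_additive unnormalized_posterior.
Proof.
apply: semi_sigma_additive_nng_induced.
  by apply/measurable_EFinP; exact: measurable_posterior_density.
by move=> x; rewrite lee_fin posterior_density_ge0.
Qed.

HB.instance Definition _ := isMeasure.Build _ _ _ unnormalized_posterior
  unnormalized_posterior0 unnormalized_posterior_ge0
  unnormalized_posterior_sigma_additive.

Lemma unnormalized_posterior_fin :
  (0 < unnormalized_posterior setT < +oo)%E.
Proof.
pose g (x : measurableTypeR R) : R := (x : R) ^+ w * (1 - (x : R)) ^+ l * f x.
have mf : measurable_fun (`]0, 1[%classic : set (measurableTypeR R)) (EFin \o f).
  by apply/measurable_EFinP; exact: density_measurable.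
have mg : measurable_fun (`]0, 1[%classic : set (measurableTypeR R)) (EFin \o g).
  apply/measurable_EFinP; apply: measurable_funM => //.
  exact: density_measurable.
have l01 (x : R) : x \in `]0, 1[ -> 0 < x ^+ w * (1 - x) ^+ l <= 1.
  rewrite in_itv/= => /andP[x0 x1].
  rewrite mulr_gt0 ?exprn_gt0 ?subr_gt0//= mulr_ile1 ?exprn_ge0 ?exprn_ile1
    ?subr_ge0 ?(ltW x0) ?(ltW x1)//.
  by rewrite gerBl ltW.
have g0 (x : R) : x \in `]0, 1[ -> 0 <= g x.
  move=> x01; apply: mulr_ge0; last exact: density_ge0.
  by case/andP: (l01 _ x01) => /ltW.
have -> : unnormalized_posterior setT =
    (\int[lebesgue_measure]_(x in `]0%R, 1%R[) (g x)%:E)%E.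
  rewrite /unnormalized_posterior [RHS]integral_mkcond; apply: eq_integral => x _.
  by rewrite /posterior_density !patchE; case: ifPn.
apply/andP; split; last first.
  apply: (@le_lt_trans _ _ 1%E); last exact: ltry.
  rewrite -(density_integral f); apply: ge0_le_integral => //= x x01.
  rewrite lee_fin; apply: ler_piMl; first exact: density_ge0.
  by case/andP: (l01 _ x01).
rewrite lt0e integral_ge0 ?andbT; last by move=> x x01; rewrite lee_fin g0.
apply/eqP => g_eq0.
have : (\int[lebesgue_measure]_(x in `]0%R, 1%R[) `|(EFin \o g) x| = 0)%E.
  rewrite -g_eq0; apply: eq_integral => x /[!inE] x01 /=.
  by rewrite ger0_norm ?g0.
move/(proj1 (ae_eq_integral_abs lebesgue_measure (measurable_itv _) mg)) => g_ae0.
have f_ae0 : ae_eq lebesgue_measure (`]0, 1[%classic : set (measurableTypeR R))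
    (EFin \o f) (cst 0%E).
  apply: filterS g_ae0 => x /= h x01; move: (h x01) => /= /eqP.
  rewrite eqe /g mulf_eq0 => /orP[|/eqP->//].
  by case/andP: (l01 _ x01) => /gt_eqF ->.
have := density_integral f.
rewrite (ae_eq_integral _ _ _ mf _ f_ae0)//= integral0 => /eqP.
by rewrite eqe eq_sym oner_eq0.
Qed.

(* [\d_0] is the value of [mnormalize] for a total mass 0 or +oo, which does
   not occur. *)
Definition leaf_posterior : law R :=
  mnormalize unnormalized_posterior (\d_(0 : measurableTypeR R)).

Lemma leaf_posteriorE A : leaf_posterior A =
  (unnormalized_posterior A * (fine (unnormalized_posterior setT))^-1%:E)%E.
Proof.
have /andP[Z0 Zy] := unnormalized_posterior_fin.
by rewrite /leaf_posterior /= /mnormalize gt_eqF// lt_eqF.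
Qed.

End leaf_posterior.

(* A history lists the (arm, reward) pairs, in the order of sampling. *)
Definition history (L : Type) := seq (L * bool).

Fixpoint posterior (R : realType) (L : eqType) (f : L -> density01 R)
    (h : history L) (t : bandit_tree L) : law R :=
  match t with
  | Leaf l => leaf_posterior (f l) (count_mem (l, true) h) (count_mem (l, false) h)
  | Node MAX n c => max_law (fun i => posterior f h (c i))
  | Node MIN n c => min_law (fun i => posterior f h (c i))
  end.

Definition weak_cvg (R : realType) (Q : nat -> law R) (Q0 : law R) : Prop :=
  forall g : R -> R, continuous g -> (exists M, forall x, `|g x| <= M) ->
  (\int[Q N]_x (g x)%:E)%E @[N --> \oo] --> (\int[Q0]_x (g x)%:E)%E.

Definition dirac_law (R : realType) (a : R) : law R :=
  \d_(a : measurableTypeR R).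

Section independence.
Context {R : realType} {d d' : measure_display} {Omega : measurableType d}
  {S : measurableType d'} (P : probability Omega R).

Definition mutually_independent (I : choiceType) (Y : I -> {RV P >-> S}) : Prop :=
  forall (J : {fset I}) (A : I -> set S), (forall i, measurable (A i)) ->
  P (\bigcap_(i in [set` J]) Y i @^-1` A i) =
  (\prod_(i <- J) P (Y i @^-1` A i))%E.

Definition sigma_of (I : Type) (Y : I -> {RV P >-> S}) : set (set Omega) :=
  <<s \bigcup_i preimage_set_system setT (Y i) measurable >>.

End independence.

Definition independent_of_family (R : realType) (d d' dE : measure_display)
    (Omega : measurableType d) (S : measurableType d') (E : measurableType dE)
    (P : probability Omega R) (U : {RV P >-> E}) (I : Type)
    (Y : I -> {RV P >-> S}) : Prop :=
  forall B F, measurable B -> sigma_of Y F ->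
  P (U @^-1` B `&` F) = (P (U @^-1` B) * P F)%E.

(* The next arm is a function of the history and of an auxiliary random element
   of [E]; the current step is the length of the history, and [E] may be a
   sequence space, so a fresh randomisation at every step is allowed. *)
Record policy (L : finType) (dE : measure_display) (E : measurableType dE) :=
  Policy {
    choose_arm :> history L -> E -> L ;
    measurable_choose_arm :
      forall h l, measurable [set u | choose_arm h u = l] }.

Definition samples (L : eqType) (l : L) (h : history L) : nat :=
  count (fun s => s.1 == l) h.

(* [X l k] is the reward of the [k]-th sample (counting from 0) of arm [l]. *)
Fixpoint run (L : finType) (dE : measure_display) (E : measurableType dE)
    (Omega : Type) (pi : policy L E) (U : Omega -> E)
    (X : L -> nat -> Omega -> bool) (N : nat) (w : Omega) : history L :=
  if N is N'.+1 then
    let h := run pi U X N' w in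
    let l := pi h (U w) in
    rcons h (l, X l (samples l h) w)
  else [::].

Definition bernoulli_arms (R : realType) (d : measure_display)
    (Omega : measurableType d) (P : probability Omega R) (L : finType)
    (p : L -> R) (X : L -> nat -> {RV P >-> bool}) : Prop :=
  (forall l k, P (X l k @^-1` [set true]) = (p l)%:E) /\
  mutually_independent (fun lk : L * nat => X lk.1 lk.2).

(* Main.v *)
(* Let g(x) = x^w (1 - x)^l be the likelihood of w rewards 1 and l rewards 0,
   n = w + l. From 1 + t <= exp t one gets
     g(x) <= g(y) exp((x - y)(w - n y) / (y (1 - y))),
   so g(x) is exponentially smaller than g(y) in n as soon as y lies strictly
   between x and w / n. This is used twice.
   - With x = p the true rate, y a tilted rate and the likelihoods summed over
     all outcomes, it is a Chernoff bound; with Borel-Cantelli it gives the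
     strong law of large numbers for each leaf.
   - With x outside a neighbourhood of p and y in a fixed interval close to p,
     it shows that the posterior of a leaf concentrates at p as soon as
     w / n --> p and n --> oo, the interval of y having positive prior mass.
   In the form "the CDF tends to 0 left of the value and to 1 right of it",
   concentration passes through finite products of CDFs, hence from the leaves
   to all nodes, and it implies weak convergence to a Dirac measure. *)

Require Import Defs.
From HB Require Import structures.
From mathcomp Require Import all_boot all_order all_algebra.
From mathcomp Require Import finmap.
From mathcomp Require Import all_classical all_reals all_analysis.
From mathcomp Require Import measurable_realfun ring lra.
Import Order.TTheory GRing.Theory Num.Theory.
Import numFieldNormedType.Exports.
Local Open Scope classical_set_scope.
Local Open Scope ring_scope.

Set Implicit Arguments.
Unset Strict Implicit.
Unset Printing Implicit Defensive.

(** * Likelihoods *)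

(** Apply [a <= b * expR ((a - b) / b)] to [x], [y] with power [w] and to [1 - x], [1 - y] with
    power [l]; the two exponents add up to the stated one. *)
Lemma likelihood_tilt (R : realType) (x y : R) (w l : nat) :
  0 <= x <= 1 -> 0 < y < 1 ->
  x ^+ w * (1 - x) ^+ l <= y ^+ w * (1 - y) ^+ l *
    expR ((x - y) * (w%:R - (w + l)%:R * y) / (y * (1 - y))).
Proof.
move=> /andP[x0 x1] /andP[y0 y1].
have y1' : 0 < 1 - y by rewrite subr_gt0.
have tilt (a b : R) n : 0 < b -> 0 <= a ->
    a ^+ n <= b ^+ n * expR (n%:R * ((a - b) / b)).
  move=> b0 a0; have h : a <= b * expR ((a - b) / b).
    rewrite -ler_pdivrMl//; apply: le_trans (expR_ge1Dx _).
    have -> : 1 + (a - b) / b = b^-1 * a by field; rewrite gt_eqF.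
    exact: lexx.
  by rewrite expRM_natl -exprMn lerXn2r// nnegrE (le_trans a0).
apply: (le_trans (ler_pM _ _ (tilt x y w y0 x0) (tilt (1 - x) (1 - y) l y1' _))).
- by rewrite exprn_ge0.
- by rewrite exprn_ge0// subr_ge0.
- by rewrite subr_ge0.
rewrite mulrACA -expRD; apply: ler_wpM2l.
  by rewrite mulr_ge0// exprn_ge0// ltW.
rewrite ler_expR le_eqVlt.
apply/orP; left; apply/eqP.
by rewrite natrD; field; rewrite !gt_eqF.
Qed.

Lemma likelihood_decay (R : realType) (x y c : R) (w l : nat) :
  0 <= x <= 1 -> 0 < y < 1 -> 0 <= c ->
  (x - y) * (w%:R - (w + l)%:R * y) <= - c ->
  x ^+ w * (1 - x) ^+ l <= expR (- c) * (y ^+ w * (1 - y) ^+ l).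
Proof.
move=> x01 y01 c0 h; apply: (le_trans (likelihood_tilt w l x01 y01)).
move: y01 => /andP[y0 y1].
have y1' : 0 < 1 - y by rewrite subr_gt0.
rewrite mulrC; apply: ler_wpM2r.
  by rewrite mulr_ge0// exprn_ge0// ltW.
rewrite ler_expR.
rewrite ler_pdivrMr ?mulr_gt0//; apply: (le_trans h).
(* Since [c >= 0], this lets the denominator be dropped. *)
have : y * (1 - y) <= 1 by nra.
nra.
Qed.

(** Without observations the likelihood is 1, so [unnormalized_posterior f 0 0] is the prior; it
    denotes the prior from here on. *)
Lemma unnormalized_posterior00 (R : realType) (f : density01 R) :
  unnormalized_posterior f 0 0 setT = 1%E.
Proof.
rewrite -(density_integral f) [RHS]integral_mkcond.
apply: eq_integral => x _.
by rewrite /posterior_density !patchE; case: ifPn; rewrite // !expr0 !mul1r.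
Qed.

(** Mass 0 would make the positive density vanish almost everywhere on the interval, which would
    then be a null set despite its length [b - a > 0]. *)
Lemma prior_itv_gt0 (R : realType) (f : density01 R) (a b : R) :
  (forall x : R, x \in `]0, 1[ -> 0 < f x) -> 0 < a -> a < b -> b < 1 ->
  (0 < unnormalized_posterior f 0 0 `[a, b])%E.
Proof.
move=> fpos a0 ab b1.
rewrite lt0e measure_ge0 andbT; apply/eqP => u0.
have mf := @measurable_funTS _ _ _ _ `[a, b]%classic _
  (measurable_posterior_density f 0 0).
have : (\int[lebesgue_measure]_(x in `[a, b])
    `|(EFin \o posterior_density f 0 0) x| = 0)%E.
  rewrite -[RHS]u0; apply: eq_integral => x _ /=.
  by rewrite ger0_norm ?posterior_density_ge0.
have mF : measurable_fun `[a, b] (EFin \o posterior_density f 0 0).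
  exact/measurable_EFinP.
move/(proj1 (ae_eq_integral_abs lebesgue_measure (measurable_itv _) mF)).
case=> N [mN N0 sub].
have : (lebesgue_measure `[a, b] <= lebesgue_measure N)%E.
  apply: le_measure; rewrite ?inE//.
  move=> x xab; apply: sub => /= /(_ xab) /= [] /eqP.
  have x01 : x \in `]0, 1[.
    by move: xab; rewrite /= !in_itv/= => /andP[ax xb]; apply/andP; split; lra.
  rewrite /posterior_density patchE ifT; last by rewrite inE.
  by rewrite !expr0 !mul1r gt_eqF// fpos.
rewrite N0 lebesgue_measure_itv/= lte_fin ab -EFinD lee_fin; lra.
Qed.

(* Bounding the mass of [A] by the likelihood at each [y] of [`[a, b]] and
   averaging over [y] against the prior avoids any comparison of a supremum
   over [A] with an infimum over [`[a, b]]. *)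
Lemma leaf_posterior_decay (R : realType) (f : density01 R) (w l : nat) (c a b : R)
    (A : set (measurableTypeR R)) :
  measurable A -> 0 < a -> b < 1 -> 0 <= c ->
  (forall x y : R, A x -> 0 < x < 1 -> a <= y <= b ->
     (x - y) * (w%:R - (w + l)%:R * y) <= - c) ->
  (leaf_posterior f w l A * unnormalized_posterior f 0 0 `[a, b] <= (expR (- c))%:E)%E.
Proof.
move=> mA a0 b1 c0 h.
set u := unnormalized_posterior f w l.
set v := unnormalized_posterior f 0 0.
have /andP[Z0 Zy] := unnormalized_posterior_fin f w l.
have uT : u setT \is a fin_num by rewrite fin_num_abs gee0_abs ?ltW.
have uA : u A \is a fin_num.
  rewrite ge0_fin_numE//; apply: (@le_lt_trans _ _ (u setT)) => //.
  by apply: le_measure; rewrite ?inE.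
have mp := measurable_posterior_density f w l.
have mp0 := measurable_posterior_density f 0 0.
have p0 x := @posterior_density_ge0 _ f w l x.
have p00 x := @posterior_density_ge0 _ f 0 0 x.
have dens (k k' : nat) (x : R) : 0 < x < 1 ->
    posterior_density f k k' x = x ^+ k * (1 - x) ^+ k' * f x.
  by move=> x01; rewrite /posterior_density patchE ifT// inE/= in_itv.
(* For fixed [y], the decay bound is integrated over [x] in [A] against the prior, whose mass on [A]
   is at most 1. *)
have step (y : R) : a <= y <= b ->
    (u A <= (expR (- c) * (y ^+ w * (1 - y) ^+ l))%:E)%E.
  move=> yab; have y01 : 0 < y < 1 by move: yab => /andP[? ?]; apply/andP; split; lra.
  have g0 : 0 <= expR (- c) * (y ^+ w * (1 - y) ^+ l).
    by move: y01 => /andP[? ?]; rewrite !mulr_ge0 ?expR_ge0 ?exprn_ge0//; lra.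
  apply: (@le_trans _ _ ((expR (- c) * (y ^+ w * (1 - y) ^+ l))%:E * v A)%E); last first.
    rewrite -[leRHS]mule1 lee_wpmul2l ?lee_fin//.
    by rewrite -(unnormalized_posterior00 f); apply: le_measure; rewrite ?inE.
  rewrite /u /v /unnormalized_posterior -ge0_integralZl//=.
  - apply: ge0_le_integral => //=.
    + by move=> x _; rewrite lee_fin.
    + by apply/measurable_EFinP; exact: measurable_funTS.
    + by apply/measurable_EFinP; apply: measurable_funTS; exact: measurable_funM.
    + move=> x Ax; rewrite -EFinM lee_fin.
      have [x01|x01] := boolP (0 < x < 1); last first.
        have nx : (x \in (`]0, 1[%classic : set R)) = false.
          by apply/negbTE; rewrite notin_setE/= in_itv; exact/negP.
        by rewrite /posterior_density !patchE nx mulr0.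
      rewrite !dens// !expr0 !mul1r.
      have fx : 0 <= f x by rewrite density_ge0// in_itv.
      rewrite ler_wpM2r// likelihood_decay ?h//.
      by move: x01 => /andP[? ?]; rewrite !ltW.
  - by apply/measurable_EFinP; exact: measurable_funTS.
  - by move=> x _; rewrite lee_fin.
(* Multiply [step] by the prior density at [y] and integrate over [[a, b]]: on the right the
   unnormalized posterior mass of [[a, b]] appears. *)
have key : (u A * v `[a, b]%classic <= (expR (- c))%:E * u setT)%E.
  apply: (@le_trans _ _ ((expR (- c))%:E * u `[a, b]%classic)%E); last first.
    by rewrite lee_wpmul2l ?lee_fin ?expR_ge0//; apply: le_measure; rewrite ?inE.
  rewrite /u /v /unnormalized_posterior -!ge0_integralZl//=; last 5 first.
  - by apply/measurable_EFinP; exact: measurable_funTS.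
  - by move=> x _; rewrite lee_fin.
  - by apply/measurable_EFinP; exact: measurable_funTS.
  - by move=> x _; rewrite lee_fin.
  - exact: (measure_ge0 u A).
  rewrite -/(unnormalized_posterior f w l A) -/u -(fineK uA).
  apply: ge0_le_integral => //=.
  - by move=> x _; rewrite -EFinM lee_fin mulr_ge0// fine_ge0.
  - by apply/measurable_EFinP; apply: measurable_funTS; exact: measurable_funM.
  - by apply/measurable_EFinP; apply: measurable_funTS; exact: measurable_funM.
  - move=> y; rewrite in_itv/= => yab.
    have y01 : 0 < y < 1 by move: yab => /andP[? ?]; apply/andP; split; lra.
    rewrite -!EFinM lee_fin !dens// !expr0 !mul1r mulrA.
    have fy : 0 <= f y by rewrite density_ge0// in_itv.
    by rewrite ler_wpM2r// -lee_fin fineK// step.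
rewrite leaf_posteriorE -/u muleAC.
have uT0 : (0 < fine (u setT))%R by apply: fine_gt0; exact/andP.
by rewrite lee_pdivrMr// fineK.
Qed.

(** * Concentration of the posteriors *)

(** Nothing is required at [a] itself, where the CDF of the Dirac measure jumps. *)
Definition concentrates (R : realType) (Q : nat -> law R) (a : R) : Prop :=
  (forall x, x < a -> cdf_of (Q N) x @[N --> \oo] --> (0 : R)) /\
  (forall x, a < x -> cdf_of (Q N) x @[N --> \oo] --> (1 : R)).

(** With [n = w N + l N], the posterior mass of [A] is at most [expR (- (n * e)) / F], where the
    prior mass [F] of [[a, b]] does not depend on [N]. *)
Lemma leaf_posterior_cvg0 (R : realType) (f : density01 R) (w l : nat -> nat)
    (e a b : R) (A : set (measurableTypeR R)) :
  (forall x : R, x \in `]0, 1[ -> 0 < f x) ->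
  measurable A -> 0 < a -> a < b -> b < 1 -> 0 < e ->
  (w N + l N)%N @[N --> \oo] --> \oo ->
  (\forall N \near \oo, forall x y : R, A x -> 0 < x < 1 -> a <= y <= b ->
     (x - y) * ((w N)%:R - (w N + l N)%:R * y) <= - ((w N + l N)%:R * e)) ->
  fine (leaf_posterior f (w N) (l N) A) @[N --> \oo] --> (0 : R).
Proof.
move=> fpos mA a0 ab b1 e0 wl h.
have F0 := prior_itv_gt0 fpos a0 ab b1.
set F := unnormalized_posterior f 0 0 `[a, b] in F0.
have Ffin : F \is a fin_num.
  rewrite ge0_fin_numE; last exact: ltW.
  apply: (@le_lt_trans _ _ 1%E); last exact: ltry.
  by rewrite /F -(unnormalized_posterior00 f); apply: le_measure; rewrite ?inE.
have fF0 : 0 < fine F by apply: fine_gt0; rewrite F0 ltey_eq Ffin.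
have c0 : (expR (- ((w N + l N)%:R * e)) / fine F) @[N --> \oo] --> (0 : R).
  rewrite -[X in _ --> X](mul0r (fine F)^-1); apply: cvgMl.
  apply: (cvg_comp (fun N => (w N + l N)%:R * e) (fun x => expR (- x)));
    last exact: cvgr_expR.
  apply/cvgryPge => r.
  have : \forall N \near \oo, r / e <= (w N + l N)%:R.
    exact: (wl [set n : nat | r / e <= n%:R] (nbhs_infty_ger _)).
  by apply: filterS => N /=; rewrite ler_pdivrMr.
apply: (squeeze_cvgr _ (cvg_cst 0) c0).
apply: filterS h => N h.
rewrite fine_ge0//= ler_pdivlMr// -lee_fin EFinM !fineK ?fin_num_measure//.
apply: leaf_posterior_decay h => //.
by rewrite mulr_ge0// ltW.
Qed.

Lemma leaf_posterior_concentrates (R : realType) (f : density01 R)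
    (w l : nat -> nat) (p : R) :
  (forall x : R, x \in `]0, 1[ -> 0 < f x) -> 0 < p < 1 ->
  (w N + l N)%N @[N --> \oo] --> \oo ->
  (forall e : R, 0 < e -> \forall N \near \oo,
     `|(w N)%:R - (w N + l N)%:R * p| <= e * (w N + l N)%:R) ->
  concentrates (fun N => leaf_posterior f (w N) (l N)) p.
Proof.
move=> fpos /andP[p0 p1] wl h; split=> x xp.
(* The maximum with [p / 2] keeps [p - 3 * e] positive even when [x <= 0]. *)
- have [e [e0 ep ex]] : exists e : R, [/\ 0 < e, 4 * e < p & x <= p - 4 * e].
    have m : Num.max x (p / 2) < p by rewrite gt_max xp/=; lra.
    have m1 : x <= Num.max x (p / 2) by rewrite le_max lexx.
    have m2 : p / 2 <= Num.max x (p / 2) by rewrite le_max lexx orbT.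
    by exists ((p - Num.max x (p / 2)) / 4); split; lra.
  (* The tail ends by [p - 4 * e], [y] stays in [[p - 3 * e, p - 2 * e]], and eventually
     [w / n >= p - e]. Both gaps around [y] are at least [e], whence the rate [e * e]. *)
  apply: (@leaf_posterior_cvg0 _ _ _ _ (e * e) (p - 3 * e) (p - 2 * e)) => //;
    rewrite ?mulr_gt0//; try lra.
  apply: filterS (h e e0) => N; rewrite ler_norml => /andP[hN _] z y /=.
  rewrite in_itv/= => zx _ /andP[y1 y2].
  have n0 : 0 <= (w N + l N)%:R :> R by [].
  move: hN n0; set n := (w N + l N)%:R => hN n0.
  have k1 : n * e <= (w N)%:R - n * y by nra.
  have k2 : e <= y - z by lra.
  have k3 : n * e * e <= ((w N)%:R - n * y) * (y - z).
    by apply: ler_pM => //; rewrite ?mulr_ge0// ltW.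
  lra.
- have [e [e0 ep ex]] : exists e : R, [/\ 0 < e, 4 * e < 1 - p & p + 4 * e <= x].
    have m : p < Num.min x ((1 + p) / 2) by rewrite lt_min xp/=; lra.
    have m1 : Num.min x ((1 + p) / 2) <= x by rewrite ge_min lexx.
    have m2 : Num.min x ((1 + p) / 2) <= (1 + p) / 2 by rewrite ge_min lexx orbT.
    by exists ((Num.min x ((1 + p) / 2) - p) / 4); split; lra.
  (* Passing to the complement turns the limit 1 into a vanishing right tail, treated as the mirror
     image of the left one. *)
  have -> : (fun N => cdf_of (leaf_posterior f (w N) (l N)) x) =
      (fun N => 1 - fine (leaf_posterior f (w N) (l N) (~` `]-oo, x]%classic))).
    apply/funext => N; rewrite /cdf_of probability_setC//.
    by rewrite fineB ?fin_num_measure//= opprB addrC subrK.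
  rewrite -[X in _ --> X](subr0 1); apply: cvgB; first exact: cvg_cst.
  apply: (@leaf_posterior_cvg0 _ _ _ _ (e * e) (p + 2 * e) (p + 3 * e)) => //;
    rewrite ?mulr_gt0//; try lra.
    exact: measurableC.
  apply: filterS (h e e0) => N; rewrite ler_norml => /andP[_ hN] z y /=.
  rewrite in_itv/= => /negP; rewrite -ltNge => zx _ /andP[y1 y2].
  have n0 : 0 <= (w N + l N)%:R :> R by [].
  move: hN n0; set n := (w N + l N)%:R => hN n0.
  have k1 : n * e <= n * y - (w N)%:R by nra.
  have k2 : e <= z - y by lra.
  have k3 : n * e * e <= (n * y - (w N)%:R) * (z - y).
    by apply: ler_pM => //; rewrite ?mulr_ge0// ltW.
  lra.
Qed.

(** * Products of CDFs and interior nodes *)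

Lemma cvg_prod1 (R : realType) (n : nat) (u : 'I_n -> nat -> R) :
  (forall i, u i N @[N --> \oo] --> (1 : R)) ->
  \prod_(i < n) u i N @[N --> \oo] --> (1 : R).
Proof.
move=> u1; have E : (1 : R) = \prod_(i < n) (1 : R) by rewrite big1.
by rewrite [X in _ --> X]E; apply: cvg_big => // -[x y]; exact: mul_continuous.
Qed.

Lemma cvg_prod0 (R : realType) (n : nat) (u : 'I_n -> nat -> R) i :
  (forall j N, 0 <= u j N <= 1) -> u i N @[N --> \oo] --> (0 : R) ->
  \prod_(j < n) u j N @[N --> \oo] --> (0 : R).
Proof.
move=> u01 ui0; apply: (squeeze_cvgr _ (cvg_cst 0) ui0).
near=> N; rewrite prodr_ge0/=; last by move=> j _; case/andP: (u01 j N).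
rewrite (bigD1 i)//= ler_piMr//; first by case/andP: (u01 i N).
by rewrite prodr_ile1// => j _; exact: u01.
Unshelve. all: by end_near. Qed.

(** Left of the maximum, some child has its value beyond [x], and its vanishing CDF kills the
    product; right of it, every factor tends to 1. *)
Lemma max_law_concentrates (R : realType) (n : nat)
    (Q : nat -> 'I_n.+1 -> law R) (v : 'I_n.+1 -> R) :
  (forall i, concentrates (fun N => Q N i) (v i)) ->
  concentrates (fun N => max_law (Q N)) (\big[Num.max/v ord0]_(i < n.+1) v i).
Proof.
move=> Qv.
have E x : (fun N => cdf_of (max_law (Q N)) x) =
    fun N => \prod_(i < n.+1) cdf_of (Q N i) x.
  by apply/funext => N; rewrite cdf_max_law.
split=> x; rewrite E.
- move=> xv; have [i xi] : exists i, x < v i.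
    by case/bigmax_gtP: xv => [|[i _]]; [exists ord0|exists i].
  apply: (@cvg_prod0 _ _ (fun i N => cdf_of (Q N i) x) i).
    by move=> j N; rewrite cdf_of_ge0 cdf_of_le1.
  exact: (Qv i).1.
- move=> /bigmax_ltP[_ vx]; apply: (@cvg_prod1 _ _ (fun i N => cdf_of (Q N i) x)).
  by move=> i; apply: (Qv i).2; exact: vx.
Qed.

(** Same argument for the factors [1 - cdf_of (Q N i) x], with left and right exchanged. *)
Lemma min_law_concentrates (R : realType) (n : nat)
    (Q : nat -> 'I_n.+1 -> law R) (v : 'I_n.+1 -> R) :
  (forall i, concentrates (fun N => Q N i) (v i)) ->
  concentrates (fun N => min_law (Q N)) (\big[Num.min/v ord0]_(i < n.+1) v i).
Proof.
move=> Qv.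
have E x : (fun N => cdf_of (min_law (Q N)) x) =
    fun N => 1 - \prod_(i < n.+1) (1 - cdf_of (Q N i) x).
  by apply/funext => N; rewrite cdf_min_law.
split=> x; rewrite E.
- move=> /bigmin_gtP[_ vx]; rewrite -[X in _ --> X](subrr 1).
  apply: cvgB; first exact: cvg_cst.
  apply: (@cvg_prod1 _ _ (fun i N => 1 - cdf_of (Q N i) x)) => i.
  rewrite -[X in _ --> X](subr0 1); apply: cvgB; first exact: cvg_cst.
  by apply: (Qv i).1; exact: vx.
- move=> xv; have [i xi] : exists i, v i < x.
    by case/bigmin_ltP: xv => [|[i _]]; [exists ord0|exists i].
  rewrite -[X in _ --> X](subr0 1); apply: cvgB; first exact: cvg_cst.
  apply: (@cvg_prod0 _ _ (fun i N => 1 - cdf_of (Q N i) x) i).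
    by move=> j N; rewrite subr_ge0 cdf_of_le1 gerBl cdf_of_ge0.
  rewrite -[X in _ --> X](subrr 1); apply: cvgB; first exact: cvg_cst.
  exact: (Qv i).2.
Qed.

(** A deterministic statement: [h] is any sequence of histories, and chance will enter only through
    the hypothesis on the leaves. *)
Lemma posterior_concentrates (R : realType) (L : eqType) (f : L -> density01 R)
    (p : L -> R) (h : nat -> history L) (t : bandit_tree L) :
  (forall l, concentrates (fun N => posterior f (h N) (Leaf l)) (p l)) ->
  concentrates (fun N => posterior f (h N) t) (minimax p t).
Proof.
move=> leafP; elim: t => [l|[] n c IH]; first exact: leafP.
- exact: (max_law_concentrates IH).
- exact: (min_law_concentrates IH).
Qed.

(** * Weak convergence *)

(** Near [a] the function [g] varies by at most [e / 2]; elsewhere [g - g a] is bounded by [2 * M],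
    and the mass there is that of two vanishing tails. *)
Lemma concentrates_weak_cvg (R : realType) (Q : nat -> law R) (a : R) :
  concentrates Q a -> weak_cvg Q (dirac_law a).
Proof.
move=> [Ql Qr] g cg [M gM].
have mg : measurable_fun (setT : set (measurableTypeR R)) (g : measurableTypeR R -> R).
  exact: continuous_measurable_fun.
have mEg : measurable_fun (setT : set (measurableTypeR R)) (EFin \o g).
  exact/measurable_EFinP.
rewrite /dirac_law integral_dirac//= diracT mul1e.
have M0 : 0 <= M by rewrite (le_trans _ (gM a)).
have int_g N : (Q N).-integrable setT (EFin \o g).
  apply: measurable_bounded_integrable => //.
    by rewrite (le_lt_trans (probability_le1 (Q N) measurableT))// ltry.
  exists M; split; [exact: num_real|].
  by move=> x Mx y _ /=; rewrite (le_trans (gM y))// ltW.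
have int_c N : (Q N).-integrable setT (fun=> (g a)%:E).
  by apply: finite_measure_integrable_cst.
pose I N := (\int[Q N]_x (g x)%:E)%E.
have If N : I N \is a fin_num by apply: integrable_fin_num => //; exact: int_g.
suff : fine (I N) @[N --> \oo] --> g a.
  move=> h; change (I N @[N --> \oo] --> (g a)%:E).
  have -> : I = EFin \o (fine \o I) by apply/funext => N /=; rewrite fineK.
  by apply: cvg_EFin => //; exact: nearW.
apply/cvgrPdist_le => e e0.
(* The half-open interval is exactly what remains after removing the tails measured by the CDFs at
   [a - eta] and [a + eta]. *)
have [eta eta0 heta] : exists2 eta : R, 0 < eta &
    forall y, a - eta < y <= a + eta -> `|g y - g a| <= e / 2.
  have /cvgrPdist_le/(_ (e / 2)) := cg a.
  rewrite divr_gt0// => /(_ isT) /nbhs_ballP[r /= r0 hr].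
  exists (r / 2); first by rewrite divr_gt0.
  move=> y /andP[y1 y2]; rewrite distrC; apply: hr.
  by rewrite /ball/= ltr_norml; apply/andP; split; lra.
have bound N : `|g a - fine (I N)| <=
    e / 2 + 2 * M * (cdf_of (Q N) (a - eta) + (1 - cdf_of (Q N) (a + eta))).
  pose A := `]-oo, a - eta]%classic : set (measurableTypeR R).
  pose B := ~` `]-oo, a + eta]%classic : set (measurableTypeR R).
  have mA : measurable A by exact: measurable_itv.
  have mB : measurable B by apply: measurableC; exact: measurable_itv.
  have QB : Q N B = (1 - cdf_of (Q N) (a + eta))%:E.
    by rewrite /B probability_setC// EFinB /cdf_of fineK// fin_num_measure.
  have QA : Q N A = (cdf_of (Q N) (a - eta))%:E.
    by rewrite /cdf_of fineK// fin_num_measure.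
  rewrite -lee_fin.
  have -> : (e / 2 + 2 * M * (cdf_of (Q N) (a - eta) + (1 - cdf_of (Q N) (a + eta))))%:E =
      ((e / 2)%:E + (2 * M)%:E * (Q N A + Q N B))%E by rewrite QA QB.
  (* [b] dominates the distance from [g x] to [g a] pointwise, and its integral is the bound
     sought. *)
  pose b (x : measurableTypeR R) : \bar R :=
    ((e / 2)%:E + (2 * M)%:E * ((\1_A x)%:E + (\1_B x)%:E))%E.
  have -> : ((e / 2)%:E + (2 * M)%:E * (Q N A + Q N B) = \int[Q N]_x b x)%E.
    rewrite /b ge0_integralD//=; last 3 first.
    - by move=> x _; rewrite lee_fin divr_ge0// ltW.
    - by move=> x _; rewrite -EFinD -EFinM lee_fin mulr_ge0 ?mulr_ge0 ?addr_ge0.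
    - apply/measurable_EFinP.
      by apply: measurable_funM => //; apply: measurable_funD; exact: measurable_indic.
    rewrite integral_cst//= probability_setT mule1 ge0_integralZl//=; last 3 first.
    - by apply/measurable_EFinP; apply: measurable_funD; exact: measurable_indic.
    - by move=> x _; rewrite -EFinD lee_fin addr_ge0.
    - by rewrite lee_fin mulr_ge0.
    rewrite ge0_integralD//=; last 2 first.
    - by apply/measurable_EFinP; exact: measurable_indic.
    - by apply/measurable_EFinP; exact: measurable_indic.
    by rewrite !integral_indic// !setIT.
  have -> : `|g a - fine (I N)|%:E = (`|\int[Q N]_x ((g x)%:E - (g a)%:E)|)%E.
    rewrite integralB//= integral_cst//= probability_setT mule1 -/(I N).
    by rewrite -(fineK (If N)) -EFinB abse_EFin distrC.
  apply: (le_trans (le_abse_integral _ _ _)) => //.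
    by apply: emeasurable_funB.
  apply: ge0_le_integral => //=.
  - apply/measurable_EFinP; apply: measurableT_comp => //.
    by apply: measurable_funB.
  - apply/measurable_EFinP; apply: measurable_funD => //.
    by apply: measurable_funM => //; apply: measurable_funD; exact: measurable_indic.
  - move=> x _; rewrite /b -!(EFinD, EFinM) lee_fin.
    have gM2 : `|g x - g a| <= 2 * M.
      by rewrite (le_trans (ler_normB _ _))//; have := gM x; have := gM a; lra.
    have [xA|xA] := boolP (x \in A).
      have Bt : 0 <= 2 * M * (x \in B)%:R by rewrite mulr_ge0// mulr_ge0.
      by rewrite !indicE xA mulrDr mulr1; lra.
    have [xB|xB] := boolP (x \in B).
      by rewrite !indicE xB (negbTE xA) add0r mulr1; lra.
    rewrite !indicE (negbTE xA) (negbTE xB) addr0 mulr0 addr0; apply: heta.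
    move: xA xB; rewrite /A /B !notin_setE/= !in_itv/=.
    by move=> /negP; rewrite -ltNge => -> /contrapT.
near=> N; apply: (le_trans (bound N)).
(* The term [+ 4] keeps the denominator positive when [M = 0]. *)
have h1 : cdf_of (Q N) (a - eta) + (1 - cdf_of (Q N) (a + eta)) <= e / (4 * M + 4).
  near: N.
  have : (cdf_of (Q N) (a - eta) + (1 - cdf_of (Q N) (a + eta))) @[N --> \oo]
      --> (0 + (1 - 1) : R).
    apply: cvgD; first by apply: Ql; lra.
    by apply: cvgB; [exact: cvg_cst|apply: Qr; lra].
  rewrite subrr addr0 => /cvgrPdist_le /(_ (e / (4 * M + 4))).
  rewrite divr_gt0//; last by lra.
  move=> /(_ isT); apply: filterS => N; rewrite sub0r normrN; apply: le_trans.
  exact: ler_norm.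
have h2 : 2 * M * (e / (4 * M + 4)) <= e / 2.
  rewrite mulrA ler_pdivrMr; last by lra.
  nra.
have : 2 * M * (cdf_of (Q N) (a - eta) + (1 - cdf_of (Q N) (a + eta))) <=
    2 * M * (e / (4 * M + 4)).
  by rewrite ler_wpM2l// mulr_ge0.
lra.
Unshelve. all: by end_near. Qed.

(** * The strong law of large numbers for Bernoulli variables *)

Section bernoulli_lln.
Context {R : realType} {d : measure_display} {Omega : measurableType d}.
Context (P : probability Omega R) (I : choiceType) (Z : I -> {RV P >-> bool}).
Context (s : nat -> I) (p : R).
Context (indep : mutually_independent Z) (s_inj : injective s) (p01 : 0 < p < 1).
Context (Zp : forall k, P (Z (s k) @^-1` [set true]) = p%:E).

Definition cylinder n (x : {ffun 'I_n -> bool}) : set Omega :=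
  [set w | forall k : 'I_n, Z (s k) w = x k].

(** This is the shape that [mutually_independent] takes: a finite set of indices in [I] and one
    event for each. The implication in the event avoids inverting [s]. *)
Let cylinderE n (x : {ffun 'I_n -> bool}) : cylinder x =
  \bigcap_(i in [set` seq_fset tt [seq s (val k) | k <- enum 'I_n]])
    Z i @^-1` [set b | forall k : 'I_n, s k = i -> b = x k].
Proof.
apply/seteqP; split => w /=.
- move=> wx i /= _ k <-; exact: wx.
- move=> h k; apply: (h (s k)) => //.
  change (s k \in seq_fset tt [seq s (val k) | k <- enum 'I_n]).
  by rewrite seq_fsetE; apply/mapP; exists k; rewrite ?mem_enum.
Qed.

Lemma measurable_cylinder n (x : {ffun 'I_n -> bool}) : measurable (cylinder x).
Proof.
rewrite cylinderE; apply: fin_bigcap_measurable; first exact: finite_fset.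
by move=> i _; apply: measurable_funPTI.
Qed.

Lemma probability_cylinder n (x : {ffun 'I_n -> bool}) :
  P (cylinder x) = (\prod_(k < n) (if x k then p else 1 - p))%:E.
Proof.
rewrite cylinderE.
rewrite (indep _ (A := fun i => [set b | forall k : 'I_n, s k = i -> b = x k]))//.
(* Injectivity of [s] makes the list of indices duplicate-free, so the product can be reindexed by
   [k < n]. *)
rewrite (perm_big [seq s (val k) | k <- enum 'I_n]); last first.
  rewrite (perm_trans (seq_fset_perm _ _))// undup_id// map_inj_uniq ?enum_uniq//.
  by move=> i j /s_inj /val_inj.
rewrite big_map big_enum -prodEFin; apply: eq_bigr => k _ /=.
have -> : [set b | forall j : 'I_n, s j = s k -> b = x j] = [set x k].
  apply/seteqP; split=> b /=; first exact.
  by move=> -> j /s_inj /val_inj ->.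
case: (x k); first exact: Zp.
rewrite EFinB -(Zp k) -probability_setC; last exact: measurable_funPTI.
by congr (P _); apply/seteqP; split=> w /=; case: (Z (s k) w).
Qed.

Definition successes n (w : Omega) : nat := \sum_(k < n) Z (s k) w.

Let prod_bernoulli n (x : {ffun 'I_n -> bool}) (q : R) :
  \prod_(k < n) (if x k then q else 1 - q) =
  q ^+ (\sum_(k < n) x k) * (1 - q) ^+ (\sum_(k < n) ~~ x k).
Proof.
rewrite -!prodrXr -big_split/=; apply: eq_bigr => k _.
by case: (x k); rewrite /= ?mulr1 ?mul1r.
Qed.

(** Distributivity: the sum is the expansion of the [n]-th power of [q + (1 - q)]. *)
Let sum_bernoulli n (q : R) :
  \sum_(x : {ffun 'I_n -> bool}) \prod_(k < n) (if x k then q else 1 - q) = 1.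
Proof.
rewrite -(bigA_distr_bigA (fun _ b => if b then q else 1 - q)).
by rewrite big1// => k _; rewrite big_bool/= addrC subrK.
Qed.

Let Boole (T : Type) (r : seq T) (Q : pred T) (A : T -> set Omega) :
  (forall t, measurable (A t)) ->
  (P (\big[setU/set0]_(t <- r | Q t) A t) <= \sum_(t <- r | Q t) P (A t))%E.
Proof.
move=> mA; elim: r => [|t r IH]; first by rewrite !big_nil measure0.
rewrite !big_cons; case: ifP => // _.
apply: le_trans (measureU2 _ _ _) _ => //; first exact: bigsetU_measurable.
exact: leeD2l.
Qed.

(** For [n > 0], the success frequency lies beyond [y], as seen from [p], by at least [e] divided by
    the distance from [p] to [y]. The product form covers both sides and matches
    [likelihood_decay]. *)
Definition deviation (y e : R) n : set Omega :=
  [set w | (p - y) * ((successes n w)%:R - n%:R * y) <= - (n%:R * e)].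

Let deviating (y e : R) n : pred {ffun 'I_n -> bool} :=
  fun x => (p - y) * ((\sum_(k < n) x k)%N%:R - n%:R * y) <= - (n%:R * e).

(** The event depends on the first [n] rewards only, so its probability reduces to a finite sum over
    outcomes. *)
Let deviationE (y e : R) n :
  deviation y e n =
  \big[setU/set0]_(x : {ffun 'I_n -> bool} | deviating y e x) cylinder x.
Proof.
rewrite -bigcup_pred; apply/seteqP; split => w /=.
- move=> h; exists [ffun k : 'I_n => Z (s k) w]; last by move=> k; rewrite ffunE.
  change (deviating y e [ffun k : 'I_n => Z (s k) w]).
  by rewrite /deviating; under eq_bigr do rewrite ffunE.
- move=> [x xd wx]; have {}xd : deviating y e x := xd.
  by rewrite /deviation /successes /=; under eq_bigr do rewrite wx.
Qed.

Lemma measurable_deviation (y e : R) n : measurable (deviation y e n).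
Proof.
rewrite deviationE; apply: bigsetU_measurable => x _; exact: measurable_cylinder.
Qed.

(* Change of measure: on the event, the likelihood of [p] is at most
   [expR (- (n%:R * e))] times the one of [y], and the latter sums to 1. *)
Lemma probability_deviation (y e : R) n : 0 < y < 1 -> 0 <= e ->
  (P (deviation y e n) <= (expR (- (n%:R * e)))%:E)%E.
Proof.
move=> y01 e0; rewrite deviationE.
apply: (le_trans (Boole _ _ (@measurable_cylinder n))).
under eq_bigr do rewrite probability_cylinder.
rewrite sumEFin lee_fin.
have -> : expR (- (n%:R * e)) = \sum_(x : {ffun 'I_n -> bool})
    expR (- (n%:R * e)) * \prod_(k < n) (if x k then y else 1 - y).
  by rewrite -mulr_sumr sum_bernoulli mulr1.
have y0 (x : {ffun 'I_n -> bool}) :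
    0 <= expR (- (n%:R * e)) * \prod_(k < n) (if x k then y else 1 - y).
  rewrite mulr_ge0 ?expR_ge0// prodr_ge0// => k _.
  by case: ifP; move: y01 => /andP[? ?]; rewrite ?subr_ge0 ltW.
(* Only the deviating outcomes are compared; the others contribute nonnegative terms on the
   right. *)
rewrite [leRHS](bigID (fun x => deviating y e x))/=.
rewrite -[leLHS]addr0; apply: lerD; last by apply: sumr_ge0 => x _; exact: y0.
apply: ler_sum => x; rewrite /deviating => xd; rewrite !prod_bernoulli.
have nE : (\sum_(k < n) x k + \sum_(k < n) ~~ x k)%N = n.
  rewrite -big_split/= -[RHS]card_ord -sum1_card; apply: eq_bigr => k _.
  by case: (x k).
apply: likelihood_decay => //; rewrite ?nE//.
- by move: p01 => /andP[? ?]; rewrite !ltW.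
- by rewrite mulr_ge0.
Qed.

(** Borel-Cantelli: the probabilities are bounded by a geometric series of ratio [expR (- e) < 1],
    so the limsup of the events is a null set. *)
Lemma eventually_no_deviation (y e : R) : 0 < y < 1 -> 0 < e ->
  {ae P, forall w, \forall n \near \oo, ~ deviation y e n w}.
Proof.
move=> y01 e0; exists (lim_sup_set (deviation y e)); split.
- apply: bigcap_measurable => // k _; apply: bigcup_measurable => j _.
  exact: measurable_deviation.
- apply: lim_sup_set_cvg0; first exact: measurable_deviation.
  have z1 : `|expR (- e)| < 1 by rewrite ger0_norm ?expR_ge0// expR_lt1 oppr_lt0.
  apply: (@le_lt_trans _ _ (\sum_(0 <= n <oo) (geometric 1 (expR (- e)) n)%:E)%E).
    apply: lee_nneseries => [n _ _|n _]; first exact: measure_ge0.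
    rewrite /geometric/= mul1r -expRM_natl mulrN.
    by apply: probability_deviation => //; exact: ltW.
  have cg := @is_cvg_geometric_series R 1 _ z1.
  rewrite (_ : (fun n => _) = EFin \o series (geometric 1 (expR (- e)))).
    by rewrite EFin_lim// ltry.
  by apply/funext => n /=; rewrite sumEFin.
- move=> w /= h n _; apply: contrapT => h'; apply: h.
  by exists n => // j /= nj dj; apply: h'; exists j.
Qed.

Lemma bernoulli_lln (e : R) : 0 < e ->
  {ae P, forall w, \forall n \near \oo, `|(successes n w)%:R - n%:R * p| <= e * n%:R}.
Proof.
move=> e0.
(* Both tilted rates [p + c] and [p - c] must lie in []0, 1[]. With slack [c * c], avoiding both
   deviations confines the error to [2 * c * n <= e * n]. *)
have [c [c0 ce cp c1]] : exists c : R, [/\ 0 < c, 2 * c <= e, c < p & c < 1 - p].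
  move: p01 => /andP[p0 p1].
  have m0 : 0 < Num.min e (Num.min p (1 - p)) by rewrite !lt_min e0 p0 subr_gt0.
  have [m1 m2 m3] : [/\ Num.min e (Num.min p (1 - p)) <= e,
      Num.min e (Num.min p (1 - p)) <= p & Num.min e (Num.min p (1 - p)) <= 1 - p].
    by rewrite !ge_min !lexx/= !orbT.
  by exists (Num.min e (Num.min p (1 - p)) / 2); split; lra.
have cc : 0 < c * c by rewrite mulr_gt0.
have up : 0 < p + c < 1 by apply/andP; split; lra.
have dn : 0 < p - c < 1 by apply/andP; split; lra.
have FF := @ae_filter_ringOfSetsType _ _ _ P.
apply: filterS2 (eventually_no_deviation up cc) (eventually_no_deviation dn cc) => w.
move=> h1 h2; near=> n.
have n0 : 0 <= n%:R :> R by [].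
have : ~ deviation (p + c) (c * c) n w by near: n; exact: h1.
have : ~ deviation (p - c) (c * c) n w by near: n; exact: h2.
rewrite /deviation /=; set S := (successes n w)%:R.
move=> /negP; rewrite -ltNge => k1 /negP; rewrite -ltNge => k2.
have {}k1 : - n%:R * c < S - n%:R * (p - c).
  rewrite -(ltr_pM2l c0); apply: le_lt_trans (_ : _ <= - (n%:R * (c * c))) _; last by lra.
  lra.
have {}k2 : S - n%:R * (p + c) < n%:R * c.
  rewrite -(ltr_pM2l c0); apply: lt_le_trans (_ : _ < n%:R * (c * c)) _; last by lra.
  lra.
have : 2 * c * n%:R <= e * n%:R by rewrite ler_wpM2r.
by rewrite ler_norml; nra.
Unshelve. all: by end_near. Qed.

End bernoulli_lln.

(** * Runs of a policy *)

Lemma count_rewards (L : eqType) (l : L) (h : history L) :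
  (count_mem (l, true) h + count_mem (l, false) h)%N = samples l h.
Proof.
rewrite /samples; elim: h => // -[a b] h IH /=.
rewrite addnACA IH !xpair_eqE; congr (_ + _)%N.
by case: b; case: (a == l).
Qed.

Section run.
Context {L : finType} {dE : measure_display} {E : measurableType dE}.
Context {Omega : Type} (pi : policy L E) (U : Omega -> E).
Context (X : L -> nat -> Omega -> bool) (w : Omega) (l : L).

(** Whatever the policy does, the rewards seen at [l] are an initial segment of the fixed sequence
    [X l], so a law of large numbers for [X l] applies along the run. *)
Lemma run_successes N : count_mem (l, true) (run pi U X N w) =
  (\sum_(k < samples l (run pi U X N w)) X l k w)%N.
Proof.
elim: N => [|N IH] /=; first by rewrite big_ord0.
set h := run pi U X N w in IH *; set a := pi h (U w).
rewrite /samples -!cats1 !count_cat -/(samples l h) IH /= addn0 xpair_eqE.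
have [al|al] := eqVneq a l.
  rewrite al addn0 addn1 big_ord_recr -/(samples l h) /=.
  by case: (X l (samples l h) w).
by rewrite !addn0.
Qed.

Lemma samples_run_le N M : (N <= M)%N ->
  (samples l (run pi U X N w) <= samples l (run pi U X M w))%N.
Proof.
move=> /subnK <-; elim: (M - N)%N => // k IH.
by rewrite addSn /= /samples -cats1 count_cat (leq_trans IH) ?leq_addr.
Qed.

Lemma samples_run_cvgy :
  (forall M : nat, exists N, (M <= samples l (run pi U X N w))%N) ->
  samples l (run pi U X N w) @[N --> \oo] --> \oo.
Proof.
move=> unb; apply/cvgnyPge => M; have [N hN] := unb M.
by exists N => // K /= NK; rewrite (leq_trans hN)// samples_run_le.
Qed.

End run.

(** * Almost sure convergence at the interior nodes *)

Theorem theorem1 (R : realType) (L : finType) (T : bandit_tree L)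
    (p : L -> R) (f : L -> density01 R)
    (d dE : measure_display) (Omega : measurableType d) (E : measurableType dE)
    (P : probability Omega R) (X : L -> nat -> {RV P >-> bool})
    (U : {RV P >-> E}) (pi : policy L E)
    (h_tree : arms_are_leaves T)
    (h_p : forall l, 0 < p l < 1)
    (h_pos : forall l (x : R), x \in `]0, 1[ -> 0 < f l x)
    (h_diff : forall l (x : R), x \in `]0, 1[ -> derivable (f l : R -> R) x 1)
    (h_bdd : forall l, exists M : R, forall x : R, x \in `]0, 1[ ->
       `|derive1 (f l : R -> R) x| <= M)
    (h_sib : siblings_distinct p T)
    (h_rewards : bernoulli_arms p X)
    (h_aux : independent_of_family U (fun lk : L * nat => X lk.1 lk.2))
    (h_sampled : {ae P, forall w, forall l (M : nat), exists N : nat,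
       (M <= samples l (run pi U X N w))%N}) :
  {ae P, forall w, forall v, node_of T v -> is_interior v ->
     weak_cvg (fun N => posterior f (run pi U X N w) v)
       (dirac_law (minimax p v))}.
Proof.
have [Xp indep] := h_rewards.
have FF := @ae_filter_ringOfSetsType _ _ _ P.
have pair_inj (l : L) : injective (pair l : nat -> L * nat) by move=> i j [].
(* Tolerances of the form [m.+1%:R^-1] leave countably many almost sure events, hence a single null
   set for all arms and tolerances. *)
have lln : {ae P, forall w, forall (l : L) (m : nat), \forall n \near \oo,
    `|(\sum_(k < n) X l k w)%N%:R - n%:R * p l| <= m.+1%:R^-1 * n%:R}.
  apply: filter_forall => l; apply: ae_foralln => m.
  by apply: (bernoulli_lln indep (@pair_inj l)) => // k; exact: Xp.
apply: filterS2 h_sampled lln => w unb lln v _ _.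
apply: concentrates_weak_cvg; apply: posterior_concentrates => l.
have cvgy := samples_run_cvgy (unb l).
apply: leaf_posterior_concentrates => //; first exact: h_pos.
  by under eq_fun do rewrite count_rewards.
move=> e e0.
have [m _ /(_ m (leqnn m)) me] := near_infty_natSinv_lt (PosNum e0).
(* On the fixed path [w], the law of large numbers is composed with the sample count of [l], which
   tends to infinity. *)
have : \forall N \near \oo, let n := samples l (run pi U X N w) in
    `|(\sum_(k < n) X l k w)%N%:R - n%:R * p l| <= m.+1%:R^-1 * n%:R.
  exact: (cvgy _ (lln l m)).
apply: filterS => N /= hN; rewrite count_rewards run_successes.
by rewrite (le_trans hN)// ler_wpM2r// ltW.
Qed.
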